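(* Let $b$ be a prime, $s,m,n\in\mathbb{N}$ with $m\le n$, let $\alpha\ge2$ be an integer, let $\boldsymbol{\gamma}=(\gamma_u)_{u\subseteq\{1,\dots,s\}}$ be non-negative real numbers, and let $p\in\mathbb{F}_b[x]$ be an irreducible polynomial with $\deg(p)=n$. Then there exists at least one vector of polynomials $\boldsymbol{q}=(q_1,\dots,q_s)\in G_{b,n}^s$ such that for the higher order polynomial lattice point set with generating vector $\boldsymbol{q}$ and modulus $p$ we have $$B_{\alpha,\boldsymbol{\gamma}}(\boldsymbol{q},p)\le\frac{1}{b^{\min(m/\lambda,4n)}}\left[\sum_{\emptyset\ne u\subseteq\{1,\dots,s\}}\gamma_u^{\lambda}C_{\alpha,b}^{\lambda|u|}\left(A_{\alpha,b,\lambda,1}^{|u|}+A_{\alpha,b,\lambda,2}^{|u|}\right)\right]^{1/\lambda}$$ for any $1/(2\alpha)<\lambda\le1$, where $$A_{\alpha,b,\lambda,1}=\frac{b}{b-1}\left[\sum_{v=1}^{\alpha-1}\prod_{i=1}^{v}\left(\frac{b-1}{b^{2\lambda i}-1}\right)+\frac{b^{2\lambda\alpha}-1}{b^{2\lambda\alpha}-b}\prod_{i=1}^{\alpha}\left(\frac{b-1}{b^{2\lambda i}-1}\right)\right]$$ and $$A_{\alpha,b,\lambda,2}=\frac{1}{b-1}\sum_{v=2}^{\alpha-1}\prod_{i=1}^{v}\left(\frac{b^{2\lambda}(b-1)}{b^{2\lambda i}-1}\right)+\frac{b^{2\lambda}}{b^{2\lambda\alpha}-b}\prod_{i=1}^{\alpha-1}\left(\frac{b^{2\lambda}(b-1)}{b^{2\lambda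 i}-1}\right).$$
   Context: $\mathbb{N}$ is the set of positive integers, $\mathbb{N}_0=\mathbb{N}\cup\{0\}$, $\mathbb{Z}_b=\mathbb{F}_b=\{0,\dots,b-1\}$ with arithmetic modulo $b$. $G_{b,n}=\{q\in\mathbb{Z}_b[x]:\deg(q)<n\}$ (the zero polynomial is included). Empty sums are $0$. Higher order polynomial lattice point set. Let $v_n$ map a formal Laurent series $\sum_{l\ge w}t_lx^{-l}\in\mathbb{Z}_b((x^{-1}))$ to $\sum_{l=\max(1,w)}^nt_lb^{-l}\in[0,1]$. Identify an integer $h=h_0+h_1b+\cdots$ with the polynomial $h(x)=h_0+h_1x+\cdots\in\mathbb{Z}_b[x]$. For $p$ with $\deg(p)=n$ and $\boldsymbol{q}\in(\mathbb{Z}_b[x])^s$, the point set $P_{b^m,s}(\boldsymbol{q},p)$ with generating vector $\boldsymbol{q}$ and modulus $p$ consists of the $b^m$ points $\boldsymbol{x}_h=\big(v_n(h(x)q_1(x)/p(x)),\dots,v_n(h(x)q_s(x)/p(x))\big)$, $0\le h<b^m$. Its dual net is $$D^{\perp}(\boldsymbol{q},p)=\{\boldsymbol{k}\in\mathbb{N}_0^s:\mathrm{tr}_n(k_1)q_1+\dots+\mathrm{tr}_n(k_s)q_s\equiv a\pmod p\text{ for some }a\in\mathbb{Z}_b[x]\text{ with }\deg(a)<n-m\},$$ where for $k=\kappa_0+\kappa_1b+\cdots$ we put $\mathrm{tr}_n(k)(x)=\kappa_0+\kappa_1x+\dots+\kappa_{n-1}x^{n-1}$, and $\deg(0)=-\infty$.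 Sum of digits. For $k=\kappa_0+\dots+\kappa_{a-1}b^{a-1}\in\mathbb{N}_0$, $\delta_b(k)=\kappa_0+\dots+\kappa_{a-1}$, and $\mathcal{E}_b=\{k\in\mathbb{N}:\delta_b(k)\equiv0\pmod b\}$. (If $k\in\mathcal{E}_b$ then $\lfloor k/b\rfloor\ge1$.) Function $\mu_\alpha$. For $k\in\mathbb{N}$ with expansion $k=\kappa_1b^{a_1-1}+\dots+\kappa_vb^{a_v-1}$, $0<\kappa_1,\dots,\kappa_v<b$, $a_1>\dots>a_v>0$, put $\mu_\alpha(k)=a_1+\dots+a_{\min(v,\alpha)}$. For $\boldsymbol{k}_u=(k_j)_{j\in u}$, $\mu_\alpha(\lfloor\boldsymbol{k}_u/b\rfloor)=\sum_{j\in u}\mu_\alpha(\lfloor k_j/b\rfloor)$. Constant $C_{\alpha,b}$. Let $\mathcal{K}_{\alpha,(1)}(x,y)=\sum_{\tau=1}^{\alpha}\frac{B_\tau(x)B_\tau(y)}{(\tau!)^2}+(-1)^{\alpha+1}\frac{B_{2\alpha}(|x-y|)}{(2\alpha)!}$ for $x,y\in[0,1]$, with $B_\tau$ the Bernoulli polynomial of degree $\tau$. Let $\hat{\mathcal{K}}_{\alpha,(1)}(k,l)=\int_0^1\int_0^1\mathcal{K}_{\alpha,(1)}(x,y)\overline{\mathrm{wal}_k(x)}\mathrm{wal}_l(y)\,\mathrm{d}x\,\mathrm{d}y$, where for $k=\kappa_0+\kappa_1b+\dots+\kappa_{a-1}b^{a-1}$ and $x=\sum_i\xi_ib^{-i}$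 (unique expansion: infinitely many digits $\ne b-1$ if $x\neq1$, all digits $b-1$ if $x=1$), $\mathrm{wal}_k(x)=\exp(2\pi\sqrt{-1}(\kappa_0\xi_1+\dots+\kappa_{a-1}\xi_a)/b)$. $C_{\alpha,b}>0$ is a fixed constant depending only on $\alpha$ and $b$ such that $|\hat{\mathcal{K}}_{\alpha,(1)}(k,l)|\le C_{\alpha,b}b^{-\mu_\alpha(k)-\mu_\alpha(l)}$ for all $k,l\in\mathbb{N}$ (such a constant is known to exist). The quantity bounded is $$B_{\alpha,\boldsymbol{\gamma}}(\boldsymbol{q},p)=\sum_{\emptyset\ne u\subseteq\{1,\dots,s\}}\gamma_uC_{\alpha,b}^{|u|}\sum_{\substack{\boldsymbol{k}_u\in\mathcal{E}_b^{|u|}\\(\boldsymbol{k}_u,\boldsymbol{0})\in D^{\perp}(\boldsymbol{q},p)}}b^{-2\mu_\alpha(\lfloor\boldsymbol{k}_u/b\rfloor)},$$ where $(\boldsymbol{k}_u,\boldsymbol{0})\in\mathbb{N}_0^s$ has $j$-th component $k_j$ for $j\in u$ and $0$ otherwise. *)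

(* Defs.v *)
From HB Require Import structures.
From mathcomp Require Import all_boot all_order all_algebra.
From mathcomp Require Import complex.
From mathcomp Require Import all_classical all_reals all_analysis.

Set Implicit Arguments.
Unset Strict Implicit.
Unset Printing Implicit Defensive.

Import Order.TTheory GRing.Theory Num.Theory.
Import numFieldNormedType.Exports.

Local Open Scope classical_set_scope.
Local Open Scope ring_scope.

(* [ndigit b k i] is the digit kappa_i in k = kappa_0 + kappa_1 b + ... .
   For b >= 2 we have k < b ^ k, so kappa_i = 0 for all i >= k; below, the
   digits of k are therefore only inspected at positions i < k. *)
Definition ndigit (b k i : nat) : nat := ((k %/ b ^ i) %% b)%N.

Definition digit_sum (b k : nat) : nat := (\sum_(i < k) ndigit b k i)%N.

Definition in_E (b k : nat) : bool := (0 < k)%N && (b %| digit_sum b k)%N.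

(* a_1 > ... > a_v > 0, where k = kappa_1 b^(a_1 - 1) + ... + kappa_v b^(a_v - 1)
   with all kappa_i nonzero. *)
Definition digit_positions (b k : nat) : seq nat :=
  [seq i.+1 | i <- rev (iota 0 k) & ndigit b k i != 0%N].

Definition mu (alpha b k : nat) : nat := sumn (take alpha (digit_positions b k)).

(* The polynomial tr_n(k) over Z_b. The field 'F_b is Z_b only for prime b. *)
Definition tr_poly (b n k : nat) : {poly 'F_b} :=
  \poly_(i < n) (ndigit b k i)%:R.

(* deg(q) < n in terms of [size q] = deg(q) + 1, with size 0 = 0, so that the
   zero polynomial is included. *)
Definition in_G (b n : nat) (q : {poly 'F_b}) : Prop := (size q <= n)%N.

Definition dual_net (b m n s : nat) (q : 'I_s -> {poly 'F_b}) (p : {poly 'F_b}) :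
    set {ffun 'I_s -> nat} :=
  [set k : {ffun 'I_s -> nat} | exists2 a : {poly 'F_b}, (size a <= n - m)%N &
     p %| (\sum_(j < s) tr_poly b n (k j) * q j) - a].

(* First n Bernoulli numbers, from B_0 = 1 and
   \sum_(j <= k) 'C(k+1, j) B_j = 0 for k >= 1. *)
Fixpoint bernoulli_seq (R : realType) (n : nat) : seq R :=
  if n is k.+1 then
    let s := bernoulli_seq R k in
    rcons s (if k == 0%N then 1
             else - (\sum_(j < k) 'C(k.+1, j)%:R * s`_j) / k.+1%:R)
  else [::].

Definition bernoulli_number (R : realType) (n : nat) : R :=
  (bernoulli_seq R n.+1)`_n.

Definition bernoulli_poly (R : realType) (n : nat) : {poly R} :=
  \poly_(i < n.+1) ('C(n, i)%:R * bernoulli_number R (n - i)).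

Definition kernel1 (R : realType) (alpha : nat) (x y : R) : R :=
  \sum_(1 <= t < alpha.+1)
     (bernoulli_poly R t).[x] * (bernoulli_poly R t).[y] / (t`!%:R) ^+ 2
  + (-1) ^+ alpha.+1 * (bernoulli_poly R (2 * alpha)).[`|x - y|]
    / ((2 * alpha)`!)%:R.

(* [rdigit b x i] is the digit xi_i (i >= 1) in x = \sum_i xi_i b^-i, x in [0, 1],
   for the expansion with infinitely many digits different from b - 1 if
   x != 1; all digits are b - 1 if x = 1. *)
Definition rdigit (R : realType) (b : nat) (x : R) (i : nat) : nat :=
  if x == 1 then b.-1 else (Num.truncn (x * b%:R ^+ i) %% b)%N.

Definition wal (R : realType) (b k : nat) (x : R) : R[i] :=
  let t : R := 2 * pi *
    (\sum_(i < k) ndigit b k i * rdigit b x i.+1)%N%:R / b%:R in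
  Complex (cos t) (sin t).

Definition cintegral01 (R : realType) (f : R -> R[i]) : R[i] :=
  Complex (\int[lebesgue_measure]_(x in `[0, 1]) complex.Re (f x))
          (\int[lebesgue_measure]_(x in `[0, 1]) complex.Im (f x)).

Definition kernel1_hat (R : realType) (alpha b k l : nat) : R[i] :=
  cintegral01 (fun y : R => cintegral01 (fun x : R =>
    (kernel1 alpha x y)%:C%C * (wal b k x)^* * wal b l y)).

(* C is an admissible choice of the constant C_{alpha,b}. *)
Definition walsh_constant (R : realType) (alpha b : nat) (C : R) : Prop :=
  0 < C /\
  forall k l : nat, (0 < k)%N -> (0 < l)%N ->
    `|kernel1_hat R alpha b k l|
      <= (C * b%:R ^- (mu alpha b k + mu alpha b l))%:C%C.

(* Vectors (k_u, 0) in D^perp with k_u in E_b^u. *)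
Definition dual_net_on (b m n s : nat) (q : 'I_s -> {poly 'F_b}) (p : {poly 'F_b})
    (u : {set 'I_s}) : set {ffun 'I_s -> nat} :=
  [set k : {ffun 'I_s -> nat} | (forall j, if j \in u then in_E b (k j) else k j == 0%N)
           /\ dual_net m n q p k].

(* The series has nonnegative terms; it is summed in the extended reals. *)
Definition B_bound (R : realType) (b m n s alpha : nat) (C : R)
    (gamma : {set 'I_s} -> R) (q : 'I_s -> {poly 'F_b}) (p : {poly 'F_b}) : \bar R :=
  (\sum_(u : {set 'I_s} | u != finset.set0)
     (gamma u * C ^+ #|u|)%:E *
     \esum_(k in dual_net_on m n q p u)
       (b%:R ^- (2 * \sum_(j in u) mu alpha b (k j %/ b)))%:E)%E.

Definition A1 (R : realType) (alpha b : nat) (lambda : R) : R :=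
  b%:R / (b%:R - 1) *
  (\sum_(1 <= v < alpha) \prod_(1 <= i < v.+1)
      ((b%:R - 1) / (b%:R `^ (2 * lambda * i%:R) - 1))
   + (b%:R `^ (2 * lambda * alpha%:R) - 1)
       / (b%:R `^ (2 * lambda * alpha%:R) - b%:R)
     * \prod_(1 <= i < alpha.+1)
         ((b%:R - 1) / (b%:R `^ (2 * lambda * i%:R) - 1))).

Definition A2 (R : realType) (alpha b : nat) (lambda : R) : R :=
  1 / (b%:R - 1) *
    (\sum_(2 <= v < alpha) \prod_(1 <= i < v.+1)
        (b%:R `^ (2 * lambda) * (b%:R - 1) / (b%:R `^ (2 * lambda * i%:R) - 1)))
  + b%:R `^ (2 * lambda) / (b%:R `^ (2 * lambda * alpha%:R) - b%:R)
    * \prod_(1 <= i < alpha)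
        (b%:R `^ (2 * lambda) * (b%:R - 1) / (b%:R `^ (2 * lambda * i%:R) - 1)).

(* Main.v *)
Require Import Defs.
From HB Require Import structures.
From mathcomp Require Import all_boot all_order all_algebra.
From mathcomp Require Import complex.
From mathcomp Require Import zify ring.
From mathcomp Require Import all_classical all_reals all_analysis.

Set Implicit Arguments.
Unset Strict Implicit.
Unset Printing Implicit Defensive.

Import Order.TTheory GRing.Theory Num.Theory.
Import numFieldNormedType.Exports.

Local Open Scope classical_set_scope.
Local Open Scope ring_scope.

(** The vector [q] is chosen to minimise [B_bound] among the finitely many vectors
    whose components have degree less than [n]; it does not depend on [lambda].
    For each [lambda] it then suffices to bound the mean over all [q] of the
    [lambda]-th power of [B_bound], or, since the series have nonnegative terms,
    of every truncation [B_trunc] of it to a large enough box of indices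
    ([lt_B_bound_trunc], [mean_B_trunc_le]).

    As [x `^ lambda] is subadditive ([powR_sum_le]), the power can be moved onto
    the single terms, which turns [b ^- (2 mu)] into [y ^+ mu] for
    [y = b `^ (- 2 lambda)]. After exchanging the sums, each index [k] is weighted
    by the proportion of the [q] that have [k] in their dual net. If some
    [tr_n(k_j)] is nonzero, it is invertible modulo the irreducible [p], so
    [\sum_j tr_n(k_j) q_j] is equidistributed modulo [p] and the proportion is at
    most [b ^- m] ([card_in_dual]). Otherwise every [k_j] is divisible by
    [b ^ n], and the proportion 1 is compensated by the size of [mu].

    Both sums over [k] are products over the components ([sum_supported]), so
    only sums over one integer in [E_b] remain. They are split by the number [v] of
    nonzero digits, capped at [alpha], and by the digit sum modulo [b]; appending
    a lowest digit gives recursions for the parts ([weight_sumS_lt],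
    [weight_sumS_ge]), of which the closed forms in [weight_bound] are fixed
    points. Summing these over [v] from 1 and over the [b] residues yields [A1].
    Restricting to digit sum 0 and to [v >= 2], the least number of nonzero digits
    of an element of [E_b], yields [A2], with the factor [y ^+ (2 * n)] that comes
    from multiplication by [b ^ n]. *)

(** * Digits in base b *)

Section Digits.
Variable b : nat.
Hypothesis b_gt1 : (1 < b)%N.
Let b_gt0 : (0 < b)%N := ltnW b_gt1.

(** Since [k < b ^ k], the digits from position [k] on vanish. *)
Lemma ndigit_ge k i : (k <= i)%N -> ndigit b k i = 0%N.
Proof.
move=> ki; rewrite /ndigit divn_small ?mod0n//.
exact: leq_ltn_trans ki (ltn_expl i b_gt1).
Qed.

Lemma ndigitS l k i : (k < b)%N -> ndigit b (l * b + k) i.+1 = ndigit b l i.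
Proof.
by move=> kb; rewrite /ndigit expnS divnMA divnMDl// (divn_small kb) addn0.
Qed.

Lemma ndigit0 l k : (k < b)%N -> ndigit b (l * b + k) 0 = k.
Proof. by move=> kb; rewrite /ndigit expn0 divn1 modnMDl modn_small. Qed.

(** The digits may be scanned over any sufficiently long range. *)
Lemma digit_positions_wide k K : (k <= K)%N ->
  digit_positions b k =
  [seq i.+1 | i <- rev (iota 0 K) & ndigit b k i != 0%N].
Proof.
move=> kK; rewrite -(subnKC kK) iotaD add0n rev_cat filter_cat map_cat.
rewrite [seq.filter _ (rev (iota k _))](_ : _ = [::])//.
apply/eqP; rewrite -(negbK (_ == _)) -has_filter; apply/hasPn => i.
by rewrite mem_rev mem_iota => /andP[ki _]; rewrite ndigit_ge.
Qed.

Lemma digit_sum_wide k K : (k <= K)%N ->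
  digit_sum b k = (\sum_(i < K) ndigit b k i)%N.
Proof.
move=> kK; rewrite -(subnKC kK) big_split_ord/= [X in (_ + X)%N]big1 ?addn0//.
by move=> i _; rewrite ndigit_ge// leq_addr.
Qed.

Lemma leq_append_digit l k : (l <= l * b + k)%N.
Proof. by rewrite (leq_trans _ (leq_addr _ _))// leq_pmulr. Qed.

(** Appending a lowest digit shifts all positions by one. *)
Lemma digit_positionsD l k : (k < b)%N ->
  digit_positions b (l * b + k) =
  map succn (digit_positions b l) ++ (if k == 0%N then [::] else [:: 1%N]).
Proof.
(* Position 0 is split off from the range of one more position than needed. *)
move=> kb; rewrite (digit_positions_wide (leqnSn (l * b + k))).
rewrite (digit_positions_wide (leq_append_digit l k)).
rewrite [iota _ _]/= rev_cons -cats1 filter_cat map_cat; congr (_ ++ _).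
  rewrite -[1%N]addn0 iotaDl -map_rev filter_map -!map_comp.
  by congr map; apply: eq_filter => i /=; rewrite ndigitS.
by rewrite /= ndigit0//; case: eqP.
Qed.

Lemma digit_sumD l k : (k < b)%N ->
  digit_sum b (l * b + k) = (digit_sum b l + k)%N.
Proof.
move=> kb; rewrite (digit_sum_wide (leqnSn (l * b + k))).
rewrite (digit_sum_wide (leq_append_digit l k)).
rewrite big_ord_recl ndigit0// addnC; congr (_ + _)%N.
by apply: eq_bigr => i _; rewrite ndigitS.
Qed.

(** The number of nonzero base [b] digits. *)
Definition nz_digits k := size (digit_positions b k).

Lemma nz_digitsD l k : (k < b)%N ->
  nz_digits (l * b + k) = (nz_digits l + (k != 0))%N.
Proof.
by move=> kb; rewrite /nz_digits digit_positionsD// size_cat size_map; case: eqP.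
Qed.

Lemma sumn_map_succ (s : seq nat) : sumn (map succn s) = (sumn s + size s)%N.
Proof. by elim: s => //= x s ->; rewrite !addSn addnS addnA. Qed.

(** Each of the at most [alpha] positions counted by [mu] moves up by one, and
    a nonzero new digit contributes its position 1 if it is still counted. *)
Lemma muD alpha l k : (k < b)%N ->
  mu alpha b (l * b + k) = (mu alpha b l + minn alpha (nz_digits (l * b + k)))%N.
Proof.
move=> kb; rewrite nz_digitsD// /mu digit_positionsD// take_cat size_map -map_take.
rewrite -/(nz_digits l); case: ltnP => [lt_a|le_a].
  rewrite sumn_map_succ size_take -/(nz_digits l) lt_a; congr (_ + _)%N.
  by rewrite (minn_idPl _)// (leq_trans (ltnW lt_a))// leq_addr.
rewrite sumn_cat sumn_map_succ -/(nz_digits l) -addnA.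
rewrite [take alpha (digit_positions b l)]take_oversize//; congr (_ + _)%N.
case: (eqVneq k 0%N) => _ /=; first by rewrite !addn0 (minn_idPr le_a).
have [->|ne] := eqVneq alpha (nz_digits l).
  by rewrite subnn/= addn0 (minn_idPl _)// addn1.
have lt_a : (nz_digits l < alpha)%N by rewrite ltn_neqAle eq_sym ne.
rewrite take_oversize/= ?subn_gt0// (minn_idPr _) ?addn1//.
Qed.

(** Multiplication by [b ^ e] shifts all nonzero digits by [e] positions, and
    [mu] counts [minn alpha (nz_digits l)] of them. *)
Lemma mu_expM alpha e l :
  mu alpha b (l * b ^ e) = (mu alpha b l + e * minn alpha (nz_digits l))%N.
Proof.
have nzE : forall e, nz_digits (l * b ^ e) = nz_digits l.
  elim=> [|f IH]; first by rewrite expn0 muln1.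
  by rewrite expnSr mulnA -[(_ * b)%N]addn0 nz_digitsD// IH addn0.
elim: e => [|e IH]; first by rewrite expn0 muln1 addn0.
rewrite expnSr mulnA -[(_ * b)%N]addn0 muD// addn0 -mulnA -expnSr nzE IH.
by rewrite mulSn addnAC addnA.
Qed.

Lemma digit_sum_expM e l : digit_sum b (l * b ^ e) = digit_sum b l.
Proof.
elim: e => [|e IH]; first by rewrite expn0 muln1.
by rewrite expnSr mulnA -[(_ * b)%N]addn0 digit_sumD// IH addn0.
Qed.

(** Induction by appending a lowest digit. *)
Lemma digit_ind (P : nat -> Prop) : P 0%N ->
  (forall l k, (k < b)%N -> P l -> P (l * b + k)%N) -> forall k, P k.
Proof.
move=> P0 PD k; elim/ltn_ind: k => k IH.
have [->//|k_gt0] := posnP k.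
rewrite (divn_eq k b); apply: PD; first by rewrite ltn_mod.
by apply: IH; rewrite ltn_Pdiv.
Qed.

Lemma nz_digits_gt0 k : (0 < nz_digits k)%N = (0 < k)%N.
Proof.
elim/digit_ind: k => // l k kb IH.
by rewrite nz_digitsD// !addn_gt0 IH muln_gt0 b_gt0 andbT -lt0n; case: (0 < k)%N.
Qed.

(** A single nonzero digit is itself the digit sum. *)
Lemma nz_digits1_digit_sum k : nz_digits k = 1%N -> (0 < digit_sum b k < b)%N.
Proof.
elim/digit_ind: k => // l k kb IH; rewrite nz_digitsD// digit_sumD//.
case: (posnP k) => [->|k_gt0]; first by rewrite !addn0.
rewrite [(nz_digits l + _)%N]addn1 => -[nz0].
have -> : l = 0%N by apply/eqP; rewrite -leqn0 leqNgt -nz_digits_gt0 nz0.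
by rewrite /digit_sum big_ord0 k_gt0.
Qed.

(** A positive integer in [E_b] has at least two nonzero digits. *)
Lemma in_E_nz_digits k : in_E b k -> (1 < nz_digits k)%N.
Proof.
case/andP; rewrite -nz_digits_gt0 leq_eqVlt => /orP[/eqP/esym|//].
move/nz_digits1_digit_sum/andP=> [d_gt0 d_lt] /dvdn_leq => /(_ d_gt0).
by rewrite leqNgt d_lt.
Qed.

Lemma dvdn_exp_ndigit n k : (forall i, (i < n)%N -> ndigit b k i = 0%N) ->
  (b ^ n %| k)%N.
Proof.
elim: n => [|n IH] zd; first by rewrite expn0 dvd1n.
have bnk : (b ^ n %| k)%N by apply: IH => i ni; apply: zd; exact: ltnW.
rewrite -(divnK bnk) expnS dvdn_pmul2r ?expn_gt0 ?b_gt0//.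
by rewrite /dvdn -/(ndigit b k n) zd.
Qed.

End Digits.

(** Summation by lowest digit. *)
Lemma sum_lowest_digit (V : nmodType) (b N : nat) (F : nat -> V) :
  \sum_(i < N * b) F i = \sum_(l < N) \sum_(k < b) F (l * b + k)%N.
Proof.
elim: N => [|N IH]; first by rewrite mul0n !big_ord0.
rewrite big_ord_recr/= -IH mulSnr big_split_ord/=; congr (_ + _).
Qed.

(** * Sums weighted by mu, split by nonzero digits and digit sum *)

(** Exactly one digit represents a given residue class. *)
Lemma sum_Fp_residue (V : nmodType) (b : nat) (b_prime : prime b) (r : 'F_b)
    (F : nat -> V) :
  \sum_(k < b | k%:R == r) F k = F r.
Proof.
rewrite (big_pred1 (cast_ord (Fp_cast b_prime) r))// => k.
rewrite -[LHS]val_eqE -[RHS]val_eqE /=.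
by rewrite (val_Fp_nat b_prime) modn_small.
Qed.

Lemma eq0_Fp_nat (b : nat) (b_prime : prime b) (k : nat) :
  (k%:R == 0 :> 'F_b) = (b %| k)%N.
Proof. by rewrite (dvdn_pcharf (pchar_Fp b_prime)). Qed.

(** The cap at [a] is reached in one step from [a] itself or from [a.-1]. *)
Lemma clip_succ_eq (a z : nat) : (0 < a)%N ->
  (minn a z.+1 == a) = (minn a z == a) || (minn a z == a.-1).
Proof. by case: (ltngtP a z.+1) => az a0; apply/eqP/orP => [?|[]/eqP]; lia. Qed.

Section WeightSums.
Variables (R : realFieldType) (b alpha : nat) (y : R).
Hypothesis b_prime : prime b.
Hypothesis alpha_gt0 : (0 < alpha)%N.
Hypotheses (y_gt0 : 0 < y) (y_lt1 : y < 1).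
Let b_gt1 : (1 < b)%N := prime_gt1 b_prime.
Let b_gt0 : (0 < b)%N := ltnW b_gt1.

(** The part of [\sum_(l < b ^ M) y ^+ mu alpha b l] that comes from the [l]
    with digit sum [r] modulo [b] and exactly [v] nonzero digits, where
    [v = alpha] stands for at least [alpha] nonzero digits. *)
Definition weight_sum M v (r : 'F_b) : R :=
  \sum_(l < b ^ M | (minn alpha (nz_digits b l) == v) &&
                    ((digit_sum b l)%:R == r)) y ^+ mu alpha b l.

(** [\prod_(i <= v) y^i / (1 - y^i)] is the sum of [y ^+ (a_1 + ... + a_v)] over
    all [a_1 > ... > a_v > 0]. *)
Definition q_prod v : R := \prod_(1 <= i < v.+1) (y ^+ i / (1 - y ^+ i)).

Lemma q_prodS v : q_prod v.+1 = q_prod v * (y ^+ v.+1 / (1 - y ^+ v.+1)).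
Proof. by rewrite /q_prod big_nat_recr. Qed.

Lemma subr_exp_gt0 v : (0 < v)%N -> 0 < 1 - y ^+ v.
Proof. by move=> v0; rewrite subr_gt0 exprn_ilt1 ?lt0n_neq0 ?ltW. Qed.

Lemma q_prod_ge0 v : 0 <= q_prod v.
Proof.
rewrite /q_prod big_add1 /=; apply: prodr_ge0 => i _.
by rewrite divr_ge0 ?exprn_ge0 ?ltW// subr_exp_gt0.
Qed.

Lemma weight_sum_init v r : (0 < v)%N -> weight_sum 0 v r = 0.
Proof.
move=> v0; rewrite /weight_sum big1// => -[l /=]; rewrite expn0 ltnS leqn0.
by move=> /eqP -> /andP[]; rewrite minn0 => /eqP v0'; rewrite -v0' in v0.
Qed.

Lemma weight_sum_nz0 M r : weight_sum M 0 r = (r == 0)%:R.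
Proof.
have b0 : (0 < b ^ M)%N by rewrite expn_gt0 b_gt0.
have E l : (minn alpha (nz_digits b l) == 0%N) = (l == 0%N).
  have := nz_digits_gt0 b_gt1 l; move: (nz_digits b l) => z zl.
  by apply/eqP/eqP; lia.
rewrite /weight_sum (eq_bigl (fun l => (l == Ordinal b0) && (0 == r))).
  by rewrite big_mkcondr big_pred1_eq /= eq_sym; case: eqP.
by case=> -[|l] lM; rewrite E -val_eqE//= /digit_sum big_ord0.
Qed.

(** The indices below [b ^ M.+1] are the [l * b + k] with [l < b ^ M]; by [muD]
    the lowest digit [k] multiplies the weight of [l] by [y ^+ v]. *)
Lemma weight_sumS M v r : weight_sum M.+1 v r =
  y ^+ v * \sum_(k < b) \sum_(l < b ^ M |
     (minn alpha (nz_digits b l + (k != 0 :> nat)) == v) &&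
     ((digit_sum b l)%:R == r - k%:R)) y ^+ mu alpha b l.
Proof.
rewrite /weight_sum big_mkcond expnSr.
rewrite (sum_lowest_digit _ _ (fun l => if (minn alpha (nz_digits b l) == v) &&
                    ((digit_sum b l)%:R == r) then y ^+ mu alpha b l else 0)).
rewrite exchange_big mulr_sumr; apply: eq_bigr => k _.
rewrite mulr_sumr [RHS]big_mkcond; apply: eq_bigr => l _.
rewrite muD// nz_digitsD// digit_sumD// natrD.
rewrite (_ : (_ + _ == r) = ((digit_sum b l)%:R == r - k%:R)); last first.
  by rewrite [RHS]eq_sym subr_eq eq_sym.
case: (minn _ _ =P v) => [->|] //=.
by case: ifP => // _; rewrite exprD mulrC.
Qed.

(** To reach [0 < v < alpha] nonzero digits, the appended digit is zero, or it is
    one of the [b - 1] others and [v.-1] nonzero digits precede it. *)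
Lemma weight_sumS_lt M v r : (0 < v < alpha)%N -> weight_sum M.+1 v r =
  y ^+ v * (weight_sum M v r +
            \sum_(k < b | k != 0 :> nat) weight_sum M v.-1 (r - k%:R)).
Proof.
case/andP=> v0 va; rewrite weight_sumS; congr (_ * _).
rewrite (bigD1 (Ordinal b_gt0))//=; congr (_ + _).
  by rewrite subr0; apply: eq_bigl => l; rewrite addn0.
apply: eq_big => [k|k k0]; first by rewrite -val_eqE.
apply: eq_bigl => l; rewrite -val_eqE/= in k0; rewrite k0; congr (_ && _).
by move: (nz_digits _ _) => z; apply/eqP/eqP; lia.
Qed.

(** To reach at least [alpha] nonzero digits, any digit may follow [alpha] or more
    nonzero ones, but only a nonzero digit may follow exactly [alpha.-1]. *)
Lemma weight_sumS_ge M r : weight_sum M.+1 alpha r =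
  y ^+ alpha * (\sum_(k < b) weight_sum M alpha (r - k%:R) +
            \sum_(k < b | k != 0 :> nat) weight_sum M alpha.-1 (r - k%:R)).
Proof.
rewrite weight_sumS; congr (_ * _).
rewrite [X in _ = _ + X]big_mkcond -big_split; apply: eq_bigr => k _ /=.
case: (nat_of_ord k =P 0%N) => [k0|k0] /=.
  by rewrite addr0; apply: eq_bigl => l; rewrite addn0.
rewrite /weight_sum big_mkcond [X in _ = X + _]big_mkcond.
rewrite [X in _ = _ + X]big_mkcond/= -big_split; apply: eq_bigr => l _ /=.
move: (nz_digits _ _) => z; case: (_ == r - _); rewrite ?andbF ?addr0// !andbT.
rewrite addn1 clip_succ_eq//; case: (_ =P alpha) => [->|_]; last by rewrite add0r.
by rewrite gtn_eqF ?addr0// prednK.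
Qed.

Let card_nz_ord : #|[pred k : 'I_b | k != 0 :> nat]| = b.-1.
Proof.
rewrite -[in RHS](card_ord b) -(cardC1 (Ordinal b_gt0)).
by apply: eq_card => k; rewrite !inE.
Qed.

(** For [v = 1] the summand vanishes unless [k] represents [r], so that the sum
    is at most 1; for larger [v] each of the [b - 1] summands is bounded. *)
Lemma sum_weight_sum_pred M v r : (0 < v)%N ->
  (forall r', (1 < v)%N ->
     weight_sum M v.-1 r' <= (b%:R - 1) ^+ v.-2 * q_prod v.-1) ->
  \sum_(k < b | k != 0 :> nat) weight_sum M v.-1 (r - k%:R)
    <= (b%:R - 1) ^+ v.-1 * q_prod v.-1.
Proof.
case: v => // -[|v] _ H /=.
  rewrite expr0 /q_prod big_geq// mulr1.
  under eq_bigr do rewrite weight_sum_nz0 subr_eq0 eq_sym.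
  rewrite -[leRHS](sum_Fp_residue b_prime r (fun=> 1 : R)).
  rewrite big_mkcond [leRHS]big_mkcond; apply: ler_sum => k _.
  by case: (_ == r); case: (_ != _); rewrite ?ler01.
apply: (@le_trans _ _ (\sum_(k < b | k != 0 :> nat)
    (b%:R - 1) ^+ v * q_prod v.+1)); first by apply: ler_sum => k _; exact: H.
rewrite sumr_const card_nz_ord -[_ *+ b.-1]mulr_natl mulrA.
by rewrite [_ ^+ v.+1]exprS -subn1 natrB.
Qed.

(** The prescribed digit sum determines one of the [v] nonzero digits from the
    others, whence the exponent [v.-1]. *)
Lemma weight_sum_le M v r : (0 < v < alpha)%N ->
  weight_sum M v r <= (b%:R - 1) ^+ v.-1 * q_prod v.
Proof.
elim: M v r => [|M IH] v r va.
  rewrite weight_sum_init ?mulr_ge0 ?q_prod_ge0 ?exprn_ge0 ?subr_ge0 ?ler1n//.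
  by case/andP: va.
rewrite weight_sumS_lt//.
have le2 : \sum_(k < b | k != 0 :> nat) weight_sum M v.-1 (r - k%:R)
    <= (b%:R - 1) ^+ v.-1 * q_prod v.-1.
  by apply: sum_weight_sum_pred => [|r' v1]; [lia|apply: IH; lia].
have le1 := lerD (IH v r va) le2.
apply: le_trans (ler_wpM2l (exprn_ge0 _ (ltW y_gt0)) le1) _.
case: v va {le1 le2} => // v va; rewrite q_prodS/=.
have /lt0r_neq0 := subr_exp_gt0 (ltn0Sn v).
by move: (y ^+ v.+1) => z z1; rewrite le_eqVlt; apply/orP; left; apply/eqP; field.
Qed.

Lemma weight_sum_ge_le M r : b%:R * y ^+ alpha < 1 ->
  weight_sum M alpha r <= (b%:R - 1) ^+ alpha.-1 * q_prod alpha.-1 *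
     (y ^+ alpha / (1 - b%:R * y ^+ alpha)).
Proof.
move=> by1; have d0 : 0 < 1 - b%:R * y ^+ alpha by rewrite subr_gt0.
elim: M r => [|M IH] r.
  rewrite weight_sum_init// mulr_ge0 ?divr_ge0 ?exprn_ge0 ?(ltW y_gt0) ?(ltW d0)//.
  by rewrite mulr_ge0 ?q_prod_ge0 ?exprn_ge0 ?subr_ge0 ?ler1n.
rewrite weight_sumS_ge.
have le2 : \sum_(k < b | k != 0 :> nat) weight_sum M alpha.-1 (r - k%:R)
    <= (b%:R - 1) ^+ alpha.-1 * q_prod alpha.-1.
  by apply: sum_weight_sum_pred => // r' v1; apply: weight_sum_le; lia.
have le1 : \sum_(k < b) weight_sum M alpha (r - k%:R) <=
    b%:R * ((b%:R - 1) ^+ alpha.-1 * q_prod alpha.-1 *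
            (y ^+ alpha / (1 - b%:R * y ^+ alpha))).
  rewrite mulr_natl -[X in _ *+ X]card_ord -sumr_const.
  by apply: ler_sum => k _; exact: IH.
apply: le_trans (ler_wpM2l (exprn_ge0 _ (ltW y_gt0)) (lerD le1 le2)) _.
move/lt0r_neq0 : d0; move: (y ^+ alpha) (_ * q_prod _) => z c z1.
by rewrite le_eqVlt; apply/orP; left; apply/eqP; field.
Qed.

End WeightSums.

(** * The constants A1 and A2 *)

Section DigitSums.
Variables (R : realType) (b alpha : nat).
Hypothesis b_prime : prime b.
Hypothesis alpha_ge2 : (2 <= alpha)%N.
Let b_gt1 : (1 < b)%N := prime_gt1 b_prime.
Let b_gt0 : (0 < b)%N := ltnW b_gt1.
Let alpha_gt0 : (0 < alpha)%N := ltnW alpha_ge2.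

(** The bound, uniform in [M] and [r], on [weight_sum alpha y M v r]. *)
Definition weight_bound (y : R) v : R :=
  if (v < alpha)%N then (b%:R - 1) ^+ v.-1 * q_prod y v
  else (b%:R - 1) ^+ alpha.-1 * q_prod y alpha.-1 *
       (y ^+ alpha / (1 - b%:R * y ^+ alpha)).

Section FixedWeight.
Variable y : R.
Hypotheses (y_gt0 : 0 < y) (y_lt1 : y < 1) (by_lt1 : b%:R * y ^+ alpha < 1).

Lemma weight_sum_bound M v (r : 'F_b) : (0 < v <= alpha)%N ->
  weight_sum alpha y M v r <= weight_bound y v.
Proof.
case/andP=> v0; rewrite /weight_bound leq_eqVlt => /orP[/eqP ->|va].
  by rewrite ltnn; exact: weight_sum_ge_le.
by rewrite va; apply: weight_sum_le => //; rewrite v0.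
Qed.

Lemma weight_bound_ge0 v : (0 < v <= alpha)%N -> 0 <= weight_bound y v.
Proof.
move=> va; apply: le_trans (weight_sum_bound 0 0 va).
by apply: sumr_ge0 => l _; rewrite exprn_ge0// ltW.
Qed.

(** Splitting a sum by the number of nonzero digits capped at [alpha]. *)
Lemma partition_nz_digits (N c : nat) (P : pred nat) (F : nat -> R) :
  (forall l, P l -> (c <= minn alpha (nz_digits b l))%N) ->
  \sum_(l < N | P l) F l = \sum_(v < alpha.+1 | (c <= v)%N)
     \sum_(l < N | P l && (minn alpha (nz_digits b l) == v)) F l.
Proof.
move=> Pc.
have lt_a l : (minn alpha (nz_digits b l) < alpha.+1)%N by rewrite ltnS geq_minl.
rewrite (partition_big (fun l : 'I_N => Ordinal (lt_a l))
  (fun v : 'I_alpha.+1 => c <= v)%N)//.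
by move=> l; exact: Pc.
Qed.

(** For each [l] there is exactly one digit [k] with [l * b + k] of digit sum
    divisible by [b], hence the sum is over all [l > 0], whatever their digit
    sums modulo [b]. *)
Lemma sum_E_le M :
  \sum_(k < b ^ M.+1 | in_E b k) y ^+ mu alpha b (k %/ b) <=
  b%:R * \sum_(v < alpha.+1 | (1 <= v)%N) weight_bound y v.
Proof.
have -> : \sum_(k < b ^ M.+1 | in_E b k) y ^+ mu alpha b (k %/ b) =
          \sum_(l < b ^ M | (0 < l)%N) y ^+ mu alpha b l.
  rewrite big_mkcond expnSr.
  rewrite (sum_lowest_digit _ _
    (fun k => if in_E b k then y ^+ mu alpha b (k %/ b) else 0)).
  rewrite [RHS]big_mkcond/=; apply: eq_bigr => l _.
  transitivity (\sum_(k < b | k%:R == (- (digit_sum b l)%:R) :> 'F_b)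
                  if (0 < l)%N then y ^+ mu alpha b l else 0); last first.
    exact: (sum_Fp_residue b_prime _
      (fun=> if (0 < l)%N then y ^+ mu alpha b l else 0)).
  rewrite [RHS]big_mkcond; apply: eq_bigr => k _.
  rewrite divnMDl// divn_small// addn0 /in_E digit_sumD// -(eq0_Fp_nat b_prime).
  rewrite natrD addrC addr_eq0 addn_gt0 muln_gt0 b_gt0 andbT.
  case: (posnP l) => [->|l0] //=; rewrite ?andTb//.
  rewrite /digit_sum big_ord0 oppr0 if_same (eq0_Fp_nat b_prime).
  by case: (posnP k) => //= k0; rewrite gtnNdvd.
rewrite (@partition_nz_digits _ 1 (fun l => 0 < l)%N
  (fun l => y ^+ mu alpha b l)); last first.
  by move=> l; rewrite -(nz_digits_gt0 b_gt1) leq_min alpha_gt0.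
rewrite mulr_sumr; apply: ler_sum => v v0.
have va : (0 < v <= alpha)%N by rewrite v0 -ltnS ltn_ord.
have -> : b%:R * weight_bound y v = \sum_(r : 'F_b) weight_bound y v.
  by rewrite sumr_const card_Fp// mulr_natl.
apply: (@le_trans _ _ (\sum_(r : 'F_b) weight_sum alpha y M v r)); last first.
  by apply: ler_sum => r _; exact: weight_sum_bound.
rewrite (partition_big (fun l : 'I_(b ^ M) => (digit_sum b l)%:R : 'F_b) xpredT)//.
apply: ler_sum => r _; rewrite /weight_sum big_mkcond [leRHS]big_mkcond/=.
apply: ler_sum => l _; case: (posnP l) => _ //=.
by case: ifP => _ //; rewrite exprn_ge0// ltW.
Qed.

(** A multiple [l * b ^ n] is in [E_b] exactly when [l] is, and then [l] has at
    least two nonzero digits. *)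
Lemma sum_E_dvd_le M n : (0 < n)%N ->
  \sum_(k < b ^ (M + n) | in_E b k && (b ^ n %| k)%N)
     y ^+ mu alpha b (k %/ b) <=
  y ^+ (2 * n) * \sum_(v < alpha.+1 | (2 <= v)%N) weight_bound y v / y ^+ v.
Proof.
move=> n_gt0; have bn_gt0 : (0 < b ^ n)%N by rewrite expn_gt0 b_gt0.
have -> : \sum_(k < b ^ (M + n) | in_E b k && (b ^ n %| k)%N)
            y ^+ mu alpha b (k %/ b) =
          \sum_(l < b ^ M | in_E b l)
             y ^+ (mu alpha b l + n.-1 * minn alpha (nz_digits b l)).
  rewrite big_mkcond expnD.
  rewrite (sum_lowest_digit _ _ (fun k => if in_E b k && (b ^ n %| k)%N
    then y ^+ mu alpha b (k %/ b) else 0)).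
  rewrite [RHS]big_mkcond/=; apply: eq_bigr => l _.
  rewrite (bigD1 (Ordinal bn_gt0))//= big1 ?addr0 => [|k k0]; last first.
    rewrite dvdn_addr ?dvdn_mull// gtnNdvd ?andbF//.
    by rewrite lt0n; apply: contra k0 => /eqP k0; apply/eqP/val_inj.
  rewrite addn0 dvdn_mull// andbT /in_E digit_sum_expM// muln_gt0 bn_gt0 andbT.
  suff -> : (l * b ^ n %/ b = l * b ^ n.-1)%N by rewrite mu_expM.
  by rewrite -[in LHS](prednK n_gt0) expnSr mulnA mulnK.
rewrite (@partition_nz_digits _ 2 (in_E b)
  (fun l => y ^+ (mu alpha b l + n.-1 * minn alpha (nz_digits b l)))); last first.
  by move=> l /(in_E_nz_digits b_gt1) l2; rewrite leq_min alpha_ge2.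
rewrite mulr_sumr; apply: ler_sum => v v2.
have va : (0 < v <= alpha)%N by rewrite (ltnW v2) -ltnS ltn_ord.
apply: (@le_trans _ _ (y ^+ (n.-1 * v) * weight_sum alpha y M v 0)).
  rewrite /weight_sum mulr_sumr big_mkcond [leRHS]big_mkcond; apply: ler_sum => l _.
  rewrite /in_E -(eq0_Fp_nat b_prime) andbC andbA andbAC.
  case: eqVneq => [<-|] //=; rewrite ?andbF//=.
  case: eqVneq => //= _; rewrite ?andbF//= ?andbT.
  by case: ifP => _; rewrite ?exprD// mulrC// mulr_ge0// exprn_ge0// ltW.
apply: (@le_trans _ _ (y ^+ (n.-1 * v) * weight_bound y v)).
  by rewrite ler_wpM2l ?exprn_ge0 ?(ltW y_gt0)//; exact: weight_sum_bound.
rewrite mulrCA mulrC; apply: ler_wpM2l; first exact: weight_bound_ge0.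
(* n.-1 * v + v = n * v >= 2 * n, and y < 1. *)
rewrite ler_pdivlMr ?exprn_gt0// -exprD -mulSnr prednK//.
by rewrite ler_wiXn2l ?ltW// mulnC leq_mul2l v2 orbT.
Qed.

End FixedWeight.

Section Constants.
Variable lambda : R.
Hypothesis lambda_gt : 1 / (2 * alpha%:R) < lambda.

(* With y = z^-1, the power y ^+ e is the lambda-th power of b ^- (2 * e). *)
Let z : R := b%:R `^ (2 * lambda).

Lemma lambda_gt0 : 0 < lambda.
Proof. by apply: lt_trans lambda_gt; rewrite divr_gt0// mulr_gt0// ltr0n. Qed.

Let bR_gt1 : 1 < b%:R :> R. Proof. by rewrite ltr1n. Qed.

Let powRE i : b%:R `^ (2 * lambda * i%:R) = z ^+ i :> R.
Proof. by rewrite powRrM powR_mulrn// powR_ge0. Qed.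

Let z_gt1 : 1 < z.
Proof.
have -> : 1 = 1 `^ (2 * lambda) :> R by rewrite powR1.
by rewrite gt0_ltr_powR ?nnegrE ?mulr_gt0 ?lambda_gt0.
Qed.

Let z_gt0 : 0 < z := lt_trans ltr01 z_gt1.

(* This is where lambda > 1 / (2 alpha) is needed. *)
Let zalpha : b%:R < z ^+ alpha.
Proof.
rewrite -powRE -[ltLHS]powRr1// /powR !gt_eqF ?(lt_trans _ bR_gt1)//.
rewrite ltr_expR ltr_pM2r ?ln_gt0// mulrAC mulrC -ltr_pdivrMr//.
by rewrite mulr_gt0 ?ltr0n.
Qed.

Let zX_gt1 i : (0 < i)%N -> 1 < z ^+ i.
Proof. by move=> i0; rewrite exprn_egt1// -lt0n. Qed.

Lemma weight_gt0 : 0 < z^-1. Proof. by rewrite invr_gt0. Qed.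
Lemma weight_lt1 : z^-1 < 1. Proof. by rewrite invf_lt1. Qed.
Lemma weight_alpha : b%:R * z^-1 ^+ alpha < 1.
Proof. by rewrite exprVn ltr_pdivrMr ?mul1r// exprn_gt0. Qed.

Let q_prodE v : q_prod z^-1 v = \prod_(1 <= i < v.+1) (z ^+ i - 1)^-1.
Proof.
rewrite /q_prod; apply: eq_big_nat => i /andP[i0 _].
have := zX_gt1 i0; rewrite exprVn; move: (z ^+ i) => t t1.
have t0 : t != 0 by rewrite gt_eqF// (lt_trans ltr01).
by field; rewrite subr_eq0 gt_eqF.
Qed.

(** The factor [b] counts the residues of the digit sum. *)
Lemma A1E :
  b%:R * \sum_(v < alpha.+1 | (1 <= v)%N) weight_bound z^-1 v = A1 alpha b lambda.
Proof.
have b1 : b%:R - 1 != 0 :> R by rewrite subr_eq0 gt_eqF.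
have prodE v : \prod_(1 <= i < v.+1)
     ((b%:R - 1) / (b%:R `^ (2 * lambda * i%:R) - 1))
   = (b%:R - 1) ^+ v * q_prod z^-1 v :> R.
  rewrite q_prodE big_split prodr_const_nat subn1 /=; congr (_ * _).
  by apply: eq_bigr => i _; rewrite powRE.
rewrite big_mkcond big_ord_recr/= alpha_gt0 -big_mkcond /A1 prodE powRE.
rewrite -mulrA; congr (_ * _); rewrite mulrDr; congr (_ + _).
  rewrite mulr_sumr big_geq_mkord; apply: eq_bigr => v v1.
  rewrite prodE /weight_bound ltn_ord; case: (v : nat) v1 => // w _ /=.
  by rewrite exprS -mulrA mulKf.
rewrite /weight_bound ltnn; case: alpha alpha_gt0 zalpha => // a _ za /=.
rewrite q_prodS exprVn [(_ - 1) ^+ a.+1]exprS; have := zX_gt1 (ltn0Sn a).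
move: (z ^+ _) za => t bt t1.
have t0 : t != 0 by rewrite gt_eqF// (lt_trans ltr01).
field; rewrite b1 t0 !subr_eq0 !gt_eqF//.
Qed.

Lemma A2E :
  \sum_(v < alpha.+1 | (2 <= v)%N) weight_bound z^-1 v / z^-1 ^+ v =
  A2 alpha b lambda.
Proof.
have b1 : b%:R - 1 != 0 :> R by rewrite subr_eq0 gt_eqF.
have prodE v : \prod_(1 <= i < v.+1)
      (z * (b%:R - 1) / (b%:R `^ (2 * lambda * i%:R) - 1))
   = z ^+ v * (b%:R - 1) ^+ v * q_prod z^-1 v :> R.
  rewrite q_prodE big_split prodr_const_nat subn1 /= exprMn; congr (_ * _).
  by apply: eq_bigr => i _; rewrite powRE.
rewrite big_mkcond big_ord_recr/= alpha_ge2 -big_mkcond /A2 powRE; congr (_ + _).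
  rewrite mulr_sumr big_geq_mkord; apply: eq_bigr => v v1.
  rewrite prodE /weight_bound ltn_ord; case: (v : nat) v1 => // w _ /=.
  rewrite exprVn invrK exprS mul1r; move: (q_prod _ _) (z ^+ _) => q t.
  rewrite [in RHS]exprS; move: (_ ^+ w) => u; by field.
rewrite /weight_bound ltnn; case: alpha alpha_gt0 zalpha => // a _ za /=.
rewrite -/z prodE exprVn invrK; move: (q_prod _ _) => q; move: za; rewrite exprS.
have : z ^+ a != 0 by rewrite gt_eqF// exprn_gt0.
move: (z ^+ a) (_ ^+ a) => t u t0 bzt.
by field; rewrite t0 subr_eq0 !gt_eqF.
Qed.

Lemma sum_E_le_A1 M :
  \sum_(k < b ^ M.+1 | in_E b k) z^-1 ^+ mu alpha b (k %/ b) <= A1 alpha b lambda.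
Proof.
rewrite -A1E.
exact: (sum_E_le weight_gt0 weight_lt1 weight_alpha).
Qed.

Lemma sum_E_dvd_le_A2 M n : (0 < n)%N ->
  \sum_(k < b ^ (M + n) | in_E b k && (b ^ n %| k)%N) z^-1 ^+ mu alpha b (k %/ b)
    <= z^-1 ^+ (2 * n) * A2 alpha b lambda.
Proof.
rewrite -A2E.
exact: (sum_E_dvd_le weight_gt0 weight_lt1 weight_alpha).
Qed.

Lemma A1_ge0 : 0 <= A1 alpha b lambda.
Proof.
apply: le_trans (sum_E_le_A1 0); apply: sumr_ge0 => k _.
by rewrite exprn_ge0// ltW// weight_gt0.
Qed.

Lemma A2_ge0 : 0 <= A2 alpha b lambda.
Proof.
rewrite -A2E; apply: sumr_ge0 => v v2.
rewrite divr_ge0 ?exprn_ge0 ?(ltW weight_gt0)//.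
apply: (weight_bound_ge0 weight_gt0 weight_lt1 weight_alpha).
by rewrite (ltnW v2) -ltnS ltn_ord.
Qed.

End Constants.
End DigitSums.

(** * Counting the generating vectors with k in the dual net *)

Lemma irreducible_coprimep (F : fieldType) (p t : {poly F}) :
  irreducible_poly p -> ~~ (p %| t) -> coprimep p t.
Proof.
move=> p_irr; apply: contraR => g1.
by rewrite -(eqp_dvdl t (p_irr.2 _ g1 (dvdp_gcdl p t))) dvdp_gcdr.
Qed.

Section Counting.
Variables (b m n s : nat) (p : {poly 'F_b}).
Hypothesis b_prime : prime b.
Hypothesis m_le_n : (m <= n)%N.
Hypothesis p_irr : irreducible_poly p.
Hypothesis p_deg : size p = n.+1.
Let b_gt1 : (1 < b)%N := prime_gt1 b_prime.

(** Generating vectors with components of degree less than [n], encoded by the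
    coefficient vectors of the components. *)
Definition gen_vec (Q : {ffun 'I_s -> 'rV['F_b]_n}) : 'I_s -> {poly 'F_b} :=
  fun j => rVpoly (Q j).

(** A decidable form of membership in the dual net. *)
Definition in_dual (q : 'I_s -> {poly 'F_b}) (k : 'I_s -> nat) : bool :=
  (size ((\sum_(j < s) tr_poly b n (k j) * q j) %% p)%R <= n - m)%N.

Let p_neq0 : p != 0. Proof. by rewrite -size_poly_gt0 p_deg. Qed.

Lemma dual_netP (q : 'I_s -> {poly 'F_b}) (k : {ffun 'I_s -> nat}) :
  dual_net m n q p k <-> in_dual q k.
Proof.
rewrite /in_dual; split=> [[a sa]|]; last first.
  move=> sk; exists ((\sum_(j < s) tr_poly b n (k j) * q j) %% p) => //.
  by apply/modp_eq0P; rewrite modpD modpN [X in _ - X]modp_small ?ltn_modp// subrr.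
move/modp_eq0P; rewrite modpD modpN => /eqP; rewrite subr_eq0 => /eqP ->.
by rewrite modp_small// p_deg ltnS (leq_trans sa)// leq_subr.
Qed.

Lemma tr_poly_eq0 k : tr_poly b n k = 0 -> (b ^ n %| k)%N.
Proof.
move=> t0; apply: dvdn_exp_ndigit => // i ni.
have /(congr1 (fun q : {poly 'F_b} => q`_i)) := t0.
rewrite coef_poly ni coef0 => /eqP; rewrite eq0_Fp_nat// /ndigit /dvdn modn_mod.
by move/eqP.
Qed.

Lemma tr_poly_ndvdp k : tr_poly b n k != 0 -> ~~ (p %| tr_poly b n k).
Proof.
move=> t0; apply/negP => /(dvdp_leq t0); rewrite p_deg ltnNge.
by rewrite (leq_trans (size_poly _ _)).
Qed.

Lemma card_small_poly :
  (#|[pred v : 'rV['F_b]_n | size (rVpoly v) <= n - m]| <= b ^ (n - m))%N.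
Proof.
have -> : (b ^ (n - m))%N = #|{: 'rV['F_b]_(n - m)}|.
  by rewrite card_mx card_Fp// mul1n.
apply: (@leq_card_in _ _ (fun v => poly_rV (rVpoly v))) => u v /= su sv uv.
by apply: (can_inj (@rVpolyK _ _)); rewrite -(poly_rV_K su) uv poly_rV_K.
Qed.

(** Replacing one component of [Q], at a [j0] with [tr_n(k_j0) != 0], by the
    residue of [\sum_j tr_n(k_j) q_j] is injective; so this residue is as often
    of degree less than [n - m] as a component is. *)
Lemma card_in_dual (k : 'I_s -> nat) (j0 : 'I_s) : tr_poly b n (k j0) != 0 ->
  (#|[pred Q | in_dual (gen_vec Q) k]| * b ^ m <=
   #|{: {ffun 'I_s -> 'rV['F_b]_n}}|)%N.
Proof.
move=> t0.
pose res Q := (\sum_(j < s) tr_poly b n (k j) * gen_vec Q j) %% p.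
pose Phi (Q : {ffun 'I_s -> 'rV['F_b]_n}) :=
  [ffun j => if j == j0 then poly_rV (res Q) else Q j].
have size_res Q : (size (res Q) <= n)%N.
  by rewrite -ltnS -p_deg ltn_modp.
have PhiI : injective Phi.
  move=> Q1 Q2 /ffunP E.
  have Ej j : j != j0 -> Q1 j = Q2 j.
    by move=> jj; have := E j; rewrite !ffunE (negPf jj).
  have : res Q1 = res Q2.
    by have := E j0; rewrite !ffunE eqxx => /(congr1 rVpoly); rewrite !poly_rV_K.
  move/eqP; rewrite -subr_eq0 /res -modpN -modpD -sumrB.
  rewrite (bigD1 j0)//= big1 => [|j jj]; last first.
    by rewrite /gen_vec Ej// subrr.
  rewrite addr0 -mulrBr => /eqP/modp_eq0P.
  rewrite Gauss_dvdpr; last first.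
    by apply: irreducible_coprimep => //; exact: tr_poly_ndvdp.
  move=> pd; suff E0 : Q1 j0 = Q2 j0.
    by apply/ffunP => j; have [->//|] := eqVneq j j0; exact: Ej.
  apply: (can_inj (@rVpolyK _ _)); apply/eqP; rewrite -subr_eq0.
  apply: contraLR pd => d0; apply/negP => /(dvdp_leq d0); rewrite p_deg ltnNge.
  by rewrite (leq_trans (size_polyD _ _))// size_polyN geq_max !size_poly.
pose small j :=
  if j == j0 then [pred v : 'rV['F_b]_n | size (rVpoly v) <= n - m]%N
  else predT.
have le_fam : (#|[pred Q | in_dual (gen_vec Q) k]| <= #|family small|)%N.
  rewrite -(fintype.card_image PhiI); apply: subset_leq_card.
  apply/fintype.subsetP => _ /fintype.imageP[Q QP ->].
  apply/familyP => j; rewrite ffunE /small; case: eqP => // _.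
  by rewrite inE poly_rV_K.
apply: leq_trans (leq_mul le_fam (leqnn _)) _.
rewrite card_family card_ffun foldrE big_image/= card_ord.
rewrite (bigD1 j0)//= {1}/small eqxx mulnAC.
have -> : (\prod_(j < s | j != j0) #|small j| = #|{: 'rV['F_b]_n}| ^ s.-1)%N.
  rewrite (eq_bigr (fun=> #|{: 'rV['F_b]_n}|)) => [|j jj]; last first.
    by rewrite /small (negPf jj).
  by rewrite prod_nat_const cardC1 card_ord.
have s0 : (0 < s)%N by rewrite (leq_ltn_trans _ (ltn_ord j0)).
rewrite -{2}(prednK s0) expnS leq_mul2r; apply/orP; right.
apply: leq_trans (leq_mul card_small_poly (leqnn _)) _.
by rewrite card_mx card_Fp// mul1n -expnD subnK.
Qed.

End Counting.

(** * Truncation of series, subadditivity of powers, sums over boxes *)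

Section Truncation.
Variables (R : realType).

Lemma esum_ge0Z (T : choiceType) (D : set T) (c : R) (f : T -> R) :
  0 <= c -> (forall x, 0 <= f x) ->
  (c%:E * (\esum_(x in D) (f x)%:E) <= \esum_(x in D) (c * f x)%:E)%E.
Proof.
move=> c_ge0 f_ge0; have [->|c_neq0] := eqVneq c 0.
  by rewrite mul0e; apply: esum_ge0 => x _; rewrite mul0r.
have c_gt0 : 0 < c by rewrite lt_def c_neq0.
rewrite -lee_pdivlMl//; apply: ge_ereal_sup => _ [X [finX XD] <-].
rewrite lee_pdivlMl// ge0_mule_fsumr => [|x]; last by rewrite lee_fin.
apply: ereal_sup_ubound; exists X; first by split.
by apply: eq_fsbigr => x _; rewrite EFinM.
Qed.

Lemma lt_esum_fset (T : choiceType) (f : T -> R) (r : R) :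
  (r%:E < \esum_(x in [set: T]) (f x)%:E)%E ->
  exists X : seq T, uniq X /\ r < \sum_(x <- X) f x.
Proof.
move=> /ereal_sup_gt[_ [X [finX _] <-]] lt_r.
exists (finmap.enum_fset (fset_set X)).
split; first exact: finmap.fset_uniq.
by move: lt_r; rewrite fsbig_finite//= sumEFin lte_fin.
Qed.

(** Every finite set of vectors of natural numbers lies in a box, so finite sums
    are dominated by sums over large boxes. *)
Lemma sum_le_box (s : nat) (X : seq {ffun 'I_s -> nat})
    (f : {ffun 'I_s -> nat} -> R) :
  uniq X -> (forall k, 0 <= f k) -> exists N0 : nat, forall N, (N0 <= N)%N ->
  \sum_(k <- X) f k <= \sum_(g : {ffun 'I_s -> 'I_N}) f [ffun j => val (g j)].
Proof.
move=> uX f_ge0; exists (\max_(k <- X) \max_j k j).+1 => -[//|N] le_N.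
pose emb (g : {ffun 'I_s -> 'I_N.+1}) := [ffun j => val (g j)].
pose proj (k : {ffun 'I_s -> nat}) : {ffun 'I_s -> 'I_N.+1} :=
  [ffun j => inord (k j)].
have XE : X = map emb (map proj X).
  rewrite -map_comp -[LHS]map_id; apply/eq_in_map => k kX.
  apply/ffunP => j; rewrite /= !ffunE /= inordK//; apply: leq_ltn_trans _ le_N.
  by rewrite (leq_trans (leq_bigmax j))// (bigD1_seq k)//= leq_max leqnn.
rewrite [in leLHS]XE big_map big_uniq; last by move: uX; rewrite {1}XE => /map_uniq.
by rewrite big_mkcond; apply: ler_sum => g _; case: ifP.
Qed.

End Truncation.

Section PowerSums.
Variable R : realType.

Lemma powRD_le (a c l : R) : 0 <= a -> 0 <= c -> 0 < l -> l <= 1 ->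
  (a + c) `^ l <= a `^ l + c `^ l.
Proof.
move=> a0 c0 l0 l1; have [->|a_neq0] := eqVneq a 0.
  by rewrite add0r powR0 ?gt_eqF// add0r.
have a_gt0 : 0 < a by rewrite lt_def a_neq0.
have ac_gt0 : 0 < a + c by rewrite ltr_wpDr.
(* As t / (a + c) lies in [0, 1], it is at most its l-th power. *)
have H t : 0 <= t -> t <= a + c -> t / (a + c) * (a + c) `^ l <= t `^ l.
  move=> t0 tac; have [->|t_neq0] := eqVneq t 0; first by rewrite !mul0r powR_ge0.
  have d_gt0 : 0 < t / (a + c) by rewrite divr_gt0// lt_def t_neq0.
  have -> : t `^ l = (t / (a + c)) `^ l * (a + c) `^ l.
    by rewrite -powRM ?(ltW d_gt0) ?(ltW ac_gt0)// divfK ?gt_eqF.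
  rewrite ler_wpM2r ?powR_ge0// ger1_powR// d_gt0 ler_pdivrMr// mul1r//.
have := lerD (H a a0 _) (H c c0 _); rewrite -!mulrDl divff ?gt_eqF// mul1r.
by apply; [rewrite lerDl|rewrite lerDr].
Qed.

(** Subadditivity of [x `^ l] for [0 < l <= 1]. *)
Lemma powR_sum_le (I : finType) (P : pred I) (F : I -> R) (l : R) :
  (forall i, P i -> 0 <= F i) -> 0 < l -> l <= 1 ->
  (\sum_(i | P i) F i) `^ l <= \sum_(i | P i) F i `^ l.
Proof.
move=> F0 l0 l1.
suff [] : 0 <= \sum_(i | P i) F i /\
          (\sum_(i | P i) F i) `^ l <= \sum_(i | P i) F i `^ l by [].
elim/big_ind2 : _ => [|x x' y y' [x0 xx'] [y0 yy']|i Pi].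
- by rewrite powR0 ?gt_eqF.
- by split; [rewrite addr_ge0|apply: le_trans (lerD xx' yy'); exact: powRD_le].
- by split; [exact: F0|].
Qed.

End PowerSums.

(** A sum over vectors with components in [P] on [u] and zero outside [u] is the
    product over [u] of the one-dimensional sums. *)
Lemma sum_supported (R : comPzRingType) (s N : nat) (u : {set 'I_s}) (P : pred nat)
    (F : nat -> R) : (0 < N)%N ->
  \sum_(g : {ffun 'I_s -> 'I_N} |
         [forall j, if j \in u then P (g j) else g j == 0%N :> nat])
     \prod_(j in u) F (g j) =
  (\sum_(k < N | P k) F k) ^+ #|u|.
Proof.
move=> N0; pose H j (k : 'I_N) : R :=
  if j \in u then if P k then F k else 0 else if k == 0%N :> nat then 1 else 0.
transitivity (\prod_j \sum_(k < N) H j k).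
  rewrite bigA_distr_bigA/= big_mkcond; apply: eq_bigr => g _.
  case: ifPn => [/forallP Pg|/forallPn[j nPj]].
    rewrite [LHS]big_mkcond; apply: eq_bigr => j _; rewrite /H.
    by have := Pg j; case: ifP => _ ->.
  by rewrite (bigD1 j)//= /H; move: nPj; case: ifP => _ /negPf ->; rewrite mul0r.
rewrite (bigID (mem u))/= [X in _ * X]big1 => [|j ju].
  rewrite mulr1 -prodr_const; apply: eq_bigr => j ju.
  by rewrite [RHS]big_mkcond; apply: eq_bigr => k _; rewrite /H ju.
rewrite (bigD1 (Ordinal N0))//= big1 => [|k k0].
  by rewrite /H (negPf ju) eqxx addr0.
by rewrite /H (negPf ju) ifF//; apply: contraNF k0 => /eqP k0; apply/eqP/val_inj.
Qed.

(** * The mean over all generating vectors *)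

(** A point of the box [[0, N)^s] as a vector of natural numbers. *)
Definition box_vec (s N : nat) (g : {ffun 'I_s -> 'I_N}) : 'I_s -> nat :=
  fun j => g j.

Section Averaging.
Variables (R : realType) (b s m n alpha : nat) (C : R).
Variables (gamma : {set 'I_s} -> R) (p : {poly 'F_b}).
Hypothesis b_prime : prime b.
Hypothesis n_gt0 : (0 < n)%N.
Hypothesis m_le_n : (m <= n)%N.
Hypothesis alpha_ge2 : (2 <= alpha)%N.
Hypothesis C_gt0 : 0 < C.
Hypothesis gamma_ge0 : forall u : {set 'I_s}, 0 <= gamma u.
Hypothesis p_irr : irreducible_poly p.
Hypothesis p_deg : size p = n.+1.
Let b_gt1 : (1 < b)%N := prime_gt1 b_prime.
Let b_gt0 : (0 < b)%N := ltnW b_gt1.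

(** [k] has the shape [(k_u, 0)] with [k_u] in [E_b ^ u]. *)
Definition supp_E (u : {set 'I_s}) (k : 'I_s -> nat) : bool :=
  [forall j, if j \in u then in_E b (k j) else k j == 0%N].

(** [mu_alpha] of the vector of the [k_j %/ b], [j] in [u]. *)
Definition mu_vec (u : {set 'I_s}) (k : 'I_s -> nat) : nat :=
  (\sum_(j in u) mu alpha b (k j %/ b))%N.

(** The quantity [B_bound] with [k] restricted to the box [[0, N)^s]. *)
Definition B_trunc (N : nat) (q : 'I_s -> {poly 'F_b}) : R :=
  \sum_(u : {set 'I_s} | u != finset.set0) gamma u * C ^+ #|u| *
     \sum_(g : {ffun 'I_s -> 'I_N} |
           supp_E u (box_vec g) && in_dual m n p q (box_vec g))
        b%:R ^- (2 * mu_vec u (box_vec g)).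

Let weight_ge0 e : 0 <= b%:R ^- e :> R.
Proof. by rewrite invr_ge0 exprn_ge0. Qed.

Let coef_ge0 (u : {set 'I_s}) : 0 <= gamma u * C ^+ #|u|.
Proof. by rewrite mulr_ge0// exprn_ge0// ltW. Qed.

Lemma lt_B_bound_trunc q (r : R) : (r%:E < B_bound m n alpha C gamma q p)%E ->
  exists N0 : nat, forall N, (N0 <= N)%N -> r < B_trunc N q.
Proof.
pose f u (k : {ffun 'I_s -> nat}) : R :=
  if supp_E u k && in_dual m n p q k then b%:R ^- (2 * mu_vec u k) else 0.
have f_ge0 u k : 0 <= f u k by rewrite /f; case: ifP.
pose G k := \sum_(u : {set 'I_s} | u != finset.set0) gamma u * C ^+ #|u| * f u k.
have le_G : (B_bound m n alpha C gamma q p <=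
             \esum_(k in [set: {ffun 'I_s -> nat}]) (G k)%:E)%E.
  have -> : \esum_(k in [set: {ffun 'I_s -> nat}]) (G k)%:E =
     (\sum_(u : {set 'I_s} | u != finset.set0)
        \esum_(k in [set: {ffun 'I_s -> nat}]) (gamma u * C ^+ #|u| * f u k)%:E)%E.
    rewrite -esum_sum => [|k u _ _]; last by rewrite lee_fin mulr_ge0.
    by apply: eq_esum => k _; rewrite sumEFin.
  rewrite /B_bound; apply: lee_sum => u _.
  apply: le_trans (esum_ge0Z _ (coef_ge0 u) (f_ge0 u)).
  apply: lee_wpmul2l; first by rewrite lee_fin.
  rewrite esum_mkcond; apply: le_esum => k _ ; rewrite /f.
  case: ifPn => [/set_mem[Ek /(dual_netP _ p_deg) Dk]|_]; last first.
    by rewrite lee_fin; case: ifP.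
  by rewrite Dk andbT ifT//; apply/forallP.
move=> lt_r; have [X [uX lt_X]] := lt_esum_fset (lt_le_trans lt_r le_G).
have G_ge0 k : 0 <= G k by apply: sumr_ge0 => u _; rewrite mulr_ge0.
have [N0 le_box] := sum_le_box uX G_ge0.
exists N0 => N /le_box; move/(lt_le_trans lt_X)/lt_le_trans; apply.
rewrite /G exchange_big/=; apply: ler_sum => u _.
rewrite -mulr_sumr ler_wpM2l// [leRHS]big_mkcond; apply: ler_sum => g _.
rewrite /f.
have -> : supp_E u [ffun j => val (g j)] = supp_E u (box_vec g).
  by apply: eq_forallb => j; rewrite ffunE.
have -> : in_dual m n p q [ffun j => val (g j)] = in_dual m n p q (box_vec g).
  by rewrite /in_dual; under eq_bigr do rewrite ffunE.
have -> // : mu_vec u [ffun j => val (g j)] = mu_vec u (box_vec g).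
by rewrite /mu_vec; under eq_bigr do rewrite ffunE.
Qed.

Section FixedLambda.
Variable lambda : R.
Hypotheses (lambda_gt : 1 / (2 * alpha%:R) < lambda) (lambda_le1 : lambda <= 1).

Let l_gt0 : 0 < lambda := lambda_gt0 alpha_ge2 lambda_gt.
Let y : R := (b%:R `^ (2 * lambda))^-1.
Let y_gt0 : 0 < y := weight_gt0 b_prime alpha_ge2 lambda_gt.
Let y_lt1 : y < 1 := weight_lt1 b_prime alpha_ge2 lambda_gt.

Let Q := {ffun 'I_s -> 'rV['F_b]_n}.

Let weight_powR e : (b%:R ^- (2 * e) : R) `^ lambda = y ^+ e.
Proof.
rewrite -powR_invn// -powRrM /y -powRN -powR_mulrn ?powR_ge0// -powRrM.
by congr (_ `^ _); rewrite natrM; ring.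
Qed.

(* The lambda-th power of gamma u * C ^+ #|u|. *)
Let cst u : R := gamma u `^ lambda * C `^ (lambda * #|u|%:R).

Let cst_ge0 u : 0 <= cst u. Proof. by rewrite mulr_ge0// powR_ge0. Qed.

(** The subadditivity is used for the sum over [u] and for the sum over [g]. *)
Lemma B_trunc_powR N q : B_trunc N q `^ lambda <=
  \sum_(u : {set 'I_s} | u != finset.set0) cst u *
     \sum_(g : {ffun 'I_s -> 'I_N} |
           supp_E u (box_vec g) && in_dual m n p q (box_vec g))
        \prod_(j in u) y ^+ mu alpha b (box_vec g j %/ b).
Proof.
apply: le_trans (powR_sum_le _ l_gt0 lambda_le1) _ => [u _|].
  by rewrite mulr_ge0// sumr_ge0.
apply: ler_sum => u _; rewrite powRM ?sumr_ge0//.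
have -> : (gamma u * C ^+ #|u|) `^ lambda = cst u.
  rewrite powRM ?exprn_ge0 ?(ltW C_gt0)//; congr (_ * _).
  by rewrite -powR_mulrn ?(ltW C_gt0)// -powRrM mulrC.
rewrite ler_wpM2l//; apply: le_trans (powR_sum_le _ l_gt0 lambda_le1) _ => //.
by apply: ler_sum => g _; rewrite weight_powR prodrXr.
Qed.

(** For a fixed [k] a proportion of at most [b ^- m] of all [q] has [k] in the
    dual net, unless all components of [k] are divisible by [b ^ n]. *)
Lemma card_in_dual_le (k : 'I_s -> nat) :
  \sum_(q : Q | in_dual m n p (gen_vec q) k) 1 <=
  #|{: Q}|%:R * (b%:R ^- m + [forall j, b ^ n %| k j]%N%:R) :> R.
Proof.
rewrite sumr_const.
have [/forallP bk|/forallPn[j0 bk]] := boolP [forall j, (b ^ n %| k j)%N].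
  rewrite mulrDr mulr1 ler_wpDl ?mulr_ge0//.
  by rewrite ler_nat max_card.
have t0 : tr_poly b n (k j0) != 0.
  by apply: contra bk => /eqP; exact: tr_poly_eq0.
rewrite addr0 ler_pdivlMr ?exprn_gt0 ?ltr0n//.
by rewrite -natrX -natrM ler_nat (card_in_dual b_prime m_le_n p_irr p_deg t0).
Qed.

(* The lambda-th power of the factor in front of the final bound. *)
Let D : R := (1 / b%:R `^ Num.min (m%:R / lambda) (4 * n%:R)) `^ lambda.

Let le_D : b%:R ^- m <= D /\ y ^+ (2 * n) <= D.
Proof.
have b1 : 1 <= b%:R :> R by rewrite ler1n.
rewrite /D div1r -powRN -powRrM.
split.
  rewrite -powR_invn//; apply: ler_powR => //.
  rewrite mulNr lerN2 -ler_pdivlMr// ge_min lexx//.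
rewrite -weight_powR -powR_invn// -powRrM; apply: ler_powR => //.
rewrite ler_wpM2r ?(ltW l_gt0)// lerN2 ge_min; apply/orP; right.
by rewrite mulnA natrM.
Qed.

(** The sum over [k] of the weights times the bounds of [card_in_dual_le]: the
    first part gives [A1], the second one, over multiples of [b ^ n], [A2]. *)
Lemma sum_supp_E_le (u : {set 'I_s}) M : u != finset.set0 ->
  \sum_(g : {ffun 'I_s -> 'I_(b ^ (M + n))} | supp_E u (box_vec g))
     (\prod_(j in u) y ^+ mu alpha b (box_vec g j %/ b)) *
     (b%:R ^- m + [forall j, b ^ n %| box_vec g j]%N%:R) <=
  D * (A1 alpha b lambda ^+ #|u| + A2 alpha b lambda ^+ #|u|).
Proof.
move=> u0; have [Dm Dn] := le_D.
have N0 : (0 < b ^ (M + n))%N by rewrite expn_gt0 b_gt0.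
have sum_ge0 (P : pred nat) N : 0 <= \sum_(k < N | P k) y ^+ mu alpha b (k %/ b).
  by apply: sumr_ge0 => k _; rewrite exprn_ge0// ltW.
under eq_bigr do rewrite mulrDr; rewrite big_split mulrDr/=; apply: lerD.
  rewrite -mulr_suml mulrC.
  rewrite (sum_supported u (in_E b) (fun k => y ^+ mu alpha b (k %/ b)) N0).
  apply: ler_pM => //; first by rewrite exprn_ge0.
  apply: lerXn2r; rewrite ?nnegrE ?sum_ge0 ?A1_ge0//.
  by rewrite -(prednK n_gt0) addnS; exact: sum_E_le_A1.
have -> : \sum_(g : {ffun 'I_s -> 'I_(b ^ (M + n))} | supp_E u (box_vec g))
     (\prod_(j in u) y ^+ mu alpha b (box_vec g j %/ b)) *
     [forall j, b ^ n %| box_vec g j]%N%:R =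
  (\sum_(k < b ^ (M + n) | in_E b k && (b ^ n %| k)%N)
      y ^+ mu alpha b (k %/ b)) ^+ #|u|.
  rewrite -(sum_supported u (fun k => in_E b k && (b ^ n %| k)%N)
     (fun k => y ^+ mu alpha b (k %/ b)) N0).
  rewrite big_mkcond [RHS]big_mkcond; apply: eq_bigr => g _.
  have -> : [forall j, if j \in u then in_E b (g j) && (b ^ n %| g j)%N
                       else g j == 0%N :> nat] =
            supp_E u (box_vec g) && [forall j, (b ^ n %| box_vec g j)%N].
    apply/forallP/andP => [H|[/forallP Eg /forallP Dg] j].
      by split; apply/forallP => j; have := H j;
        case: ifP => // _; [case/andP|case/andP|rewrite /box_vec => /eqP ->].
    by have := Eg j; case: ifP => // _ ->; exact: Dg.
  by case: (supp_E u (box_vec g)) => //=; case: ifP => _; rewrite ?mulr1 ?mulr0.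
apply: (@le_trans _ _ ((y ^+ (2 * n) * A2 alpha b lambda) ^+ #|u|)).
  apply: lerXn2r; last exact: sum_E_dvd_le_A2.
    exact: (sum_ge0 (fun k => in_E b k && (b ^ n %| k)%N)).
  by rewrite nnegrE mulr_ge0 ?exprn_ge0 ?(ltW y_gt0) ?A2_ge0.
rewrite exprMn ler_wpM2r ?exprn_ge0 ?A2_ge0//; apply: le_trans Dn.
(* u is nonempty, so the #|u|-th power of y ^+ (2 * n) <= 1 only decreases. *)
rewrite -[leRHS]expr1 ler_wiXn2l ?exprn_ge0 ?exprn_ile1 ?(ltW y_gt0) ?(ltW y_lt1)//.
by rewrite card_gt0.
Qed.

Let S := \sum_(u : {set 'I_s} | u != finset.set0)
  cst u * (A1 alpha b lambda ^+ #|u| + A2 alpha b lambda ^+ #|u|).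

Lemma mean_B_trunc_le M :
  \sum_(q : Q) B_trunc (b ^ (M + n)) (gen_vec q) `^ lambda <= #|{: Q}|%:R * (D * S).
Proof.
apply: le_trans (ler_sum _ (fun q _ => B_trunc_powR _ _)) _.
rewrite exchange_big/= /S !mulr_sumr; apply: ler_sum => u u0.
rewrite -mulr_sumr [X in _ <= _ * X]mulrCA [leRHS]mulrCA; apply: ler_wpM2l => //.
apply: le_trans (ler_wpM2l (ler0n _ _) (sum_supp_E_le M u0)).
rewrite (exchange_big_dep (fun g : {ffun 'I_s -> 'I_(b ^ (M + n))} =>
  supp_E u (box_vec g)))/=; last first.
  by move=> q g _ /andP[].
rewrite mulr_sumr; apply: ler_sum => g Eg; rewrite mulrCA.
rewrite (eq_bigl (fun q => in_dual m n p (gen_vec q) (box_vec g))); last first.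
  by move=> q; rewrite Eg.
rewrite -[X in X <= _]mulr1 mulr_suml.
apply: le_trans (ler_wpM2l _ (card_in_dual_le (box_vec g))).
  by rewrite mulr_sumr; apply: ler_sum => q _.
by apply: prodr_ge0 => j _; rewrite exprn_ge0// ltW.
Qed.

Lemma exists_B_trunc_le M : exists q : Q, B_trunc (b ^ (M + n)) (gen_vec q) <=
  1 / b%:R `^ Num.min (m%:R / lambda) (4 * n%:R) * S `^ (1 / lambda).
Proof.
pose r := 1 / b%:R `^ Num.min (m%:R / lambda) (4 * n%:R) * S `^ (1 / lambda).
apply: contrapT => /forallNP noq.
have S_ge0 : 0 <= S.
  apply: sumr_ge0 => u _; rewrite mulr_ge0// addr_ge0// exprn_ge0//.
    exact: A1_ge0.
  exact: A2_ge0.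
have r_ge0 : 0 <= r by rewrite mulr_ge0 ?powR_ge0// div1r invr_ge0 powR_ge0.
have rE : r `^ lambda = D * S.
  rewrite powRM ?powR_ge0 ?div1r ?invr_ge0 ?powR_ge0//.
  rewrite -powRrM mulVf ?gt_eqF// powRr1//.
  by rewrite /D div1r.
have := mean_B_trunc_le M; rewrite leNgt => /negP; apply.
rewrite -rE mulr_natl -sumr_const; apply: ltr_sum => [|q _].
  apply/hasP; exists [ffun=> 0] => //; exact: mem_index_enum.
have ltq : r < B_trunc (b ^ (M + n)) (gen_vec q) by rewrite ltNge; apply/negP/noq.
by rewrite gt0_ltr_powR ?nnegrE// (le_trans r_ge0 (ltW ltq)).
Qed.

End FixedLambda.
End Averaging.

Theorem theorem23 (R : realType) (b s m n alpha : nat) (C : R)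
    (gamma : {set 'I_s} -> R) (p : {poly 'F_b})
    (b_prime : prime b) (s_gt0 : (0 < s)%N) (m_gt0 : (0 < m)%N)
    (n_gt0 : (0 < n)%N) (m_le_n : (m <= n)%N) (alpha_ge2 : (2 <= alpha)%N)
    (C_walsh : walsh_constant alpha b C)
    (gamma_ge0 : forall u : {set 'I_s}, 0 <= gamma u)
    (p_irr : irreducible_poly p) (p_deg : size p = n.+1) :
  exists q : 'I_s -> {poly 'F_b},
    (forall j, in_G n (q j)) /\
    forall lambda : R, 1 / (2 * alpha%:R) < lambda -> lambda <= 1 ->
      (B_bound m n alpha C gamma q p <=
        (1 / b%:R `^ Num.min (m%:R / lambda) (4 * n%:R) *
         (\sum_(u : {set 'I_s} | u != finset.set0)
            (gamma u `^ lambda) * C `^ (lambda * #|u|%:R) *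
            (A1 alpha b lambda ^+ #|u| + A2 alpha b lambda ^+ #|u|))
         `^ (1 / lambda))%:E)%E.
Proof.
have C_gt0 := C_walsh.1.
pose Q := {ffun 'I_s -> 'rV['F_b]_n}.
pose B (q : Q) := B_bound m n alpha C gamma (gen_vec q) p.
(* The minimiser q is fixed before lambda. *)
have [q q_min] : exists q : Q, forall q' : Q, (B q <= B q')%E.
  case: (@Order.TotalTheory.arg_minP _ _ Q [ffun=> 0] xpredT B) => // q _ qP.
  by exists q => q'; exact: qP.
exists (gen_vec q); split=> [j|lambda l_gt l_le1]; first exact: size_poly.
rewrite leNgt; apply/negP; set r := (X in (X%:E < _)%E) => lt_r.
(* If q exceeds the bound r, so does every q', and already in a common box. *)
have /choice[N0 N0P] (q' : Q) : exists N0 : nat, forall N, (N0 <= N)%N ->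
    r < B_trunc m n alpha C gamma p N (gen_vec q').
  apply: (lt_B_bound_trunc C_gt0 gamma_ge0 p_deg).
  exact: lt_le_trans lt_r (q_min q').
pose M := \max_(q' : Q) N0 q'.
have [q' le_r] := exists_B_trunc_le b_prime n_gt0 m_le_n alpha_ge2 C_gt0
  gamma_ge0 p_irr p_deg l_gt l_le1 M.
have : r < B_trunc m n alpha C gamma p (b ^ (M + n)) (gen_vec q').
  apply: N0P; apply: (leq_trans (leq_bigmax q')).
  by rewrite (leq_trans (leq_addr n M))// ltnW// ltn_expl// prime_gt1.
by rewrite ltNge le_r.
Qed.
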